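(* There is a constant $c>0$ such that for every $n\ge 2$ and every undirected graph $G$ with $n$ vertices the following holds: if $\chi$ is the initial coloring of $G$ and $\chi_{\mathsf{WL}}^m$ denotes the result of $m$ applications of the $2$-dimensional Weisfeiler-Leman refinement to $\chi$, then there is some $m\le c\, n\log n$ with $\pi(\chi_{\mathsf{WL}}^{m})=\pi(\chi_{\mathsf{WL}}^{m+1})$. That is, the $2$-dimensional Weisfeiler-Leman algorithm stabilizes after $\mathcal{O}(n\log n)$ iterations on graphs with $n$ vertices.
   Context: For an undirected graph $G=(V,E)$, its initial coloring $\chi\colon V^2\to\{-1,0,1\}$ is given by $\chi(v,v)=-1$, $\chi(u,v)=1$ if $u\ne v$ and $\{u,v\}\in E$, and $\chi(u,v)=0$ otherwise. For a coloring $\chi$ of $V^2$, the $2$-dimensional Weisfeiler-Leman refinement produces the coloring $\chi_{\mathsf{WL}}(u,v):=\{\!\{(\chi(u,w),\chi(w,v)) : w\in V\}\!\}$ (a multiset); iterating gives $\chi_{\mathsf{WL}}^{m+1}=(\chi_{\mathsf{WL}}^m)_{\mathsf{WL}}$, $\chi_{\mathsf{WL}}^0=\chi$. $\pi(\chi)$ denotes the partition of $V^2$ into color classes of $\chi$. *)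

(* Defs.v *)
From mathcomp Require Import all_boot all_algebra.
From mathcomp Require Import finmap multiset.

Set Implicit Arguments.
Unset Strict Implicit.
Unset Printing Implicit Defensive.

Import GRing.Theory.

Local Open Scope ring_scope.
Local Open Scope mset_scope.

(** A graph on [V] is given by its adjacency relation. Loops, if there are any,
    are ignored because the first test takes precedence. *)
Definition init_coloring (V : finType) (e : rel V) (uv : V * V) : int :=
  if uv.1 == uv.2 then - 1 else if e uv.1 uv.2 then 1 else 0.

(** The multiset alone is the new color: the old color is not paired with it. *)
Definition wl_refine (V : finType) (C : choiceType) (chi : V * V -> C)
    (uv : V * V) : {mset C * C} :=
  seq_mset [seq (chi (uv.1, w), chi (w, uv.2)) | w <- enum V].

(** The type of colors changes with each round: a color of round [m.+1] is a
    multiset of pairs of colors of round [m]. *)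
Fixpoint wl_color (C : choiceType) (m : nat) : choiceType :=
  if m is m'.+1 then {mset wl_color C m' * wl_color C m'} else C.

Fixpoint wl_iter (V : finType) (C : choiceType) (chi : V * V -> C) (m : nat) :
    V * V -> wl_color C m :=
  match m return V * V -> wl_color C m with
  | 0%N => chi
  | m'.+1 => wl_refine (wl_iter chi m')
  end.

Definition color_partition (V : finType) (C : choiceType) (chi : V * V -> C) :
    {set {set V * V}} :=
  preim_partition chi [set: V * V].

(* Main.v *)
(** Let [U m] be the space of complex matrices that are constant on the color
    classes of round [m]. A refinement round gives [U m * U m <= U m.+1], so the
    algebra generated by [U m], which is spanned by words of length less than
    [n ^ 2], lies in [U (m + k)] once [n ^ 2 <= 2 ^ k]. Along the multiples of
    [k] these algebras form an increasing chain of self-adjoint algebras of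
    [n x n] matrices; as soon as two consecutive ones agree, the corresponding
    [U m] is itself an algebra, which says precisely that the coloring is stable.

    A strict chain of such algebras has length at most [2 n]. Writing
    [A ~ M_d1 + ... + M_dc], both [d1 + ... + dc] and
    [(d1 - 1) + ... + (dc - 1)] are monotone in [A]; if neither changes from [A]
    to [B], then [A] and [B] share a system of primitive orthogonal projections
    [E i] with the same linking relation [E i A E j != 0]; each nonzero Peirce
    corner [E i A E j] is a line, so [A = B]. *)
Require Import Defs.
From mathcomp Require Import all_boot all_algebra.
From mathcomp Require Import reals exp.
From mathcomp Require Import all_order all_field finmap multiset boolp.

Set Implicit Arguments.
Unset Strict Implicit.
Unset Printing Implicit Defensive.

Import Order.TTheory GRing.Theory Num.Theory.

Local Open Scope ring_scope.

(** * Conjugate transposes and orthogonal projections *)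

Section Adjoint.
Variables (C : numClosedFieldType) (n : nat).
Local Notation M := 'M[C]_n.+1.
Implicit Types x y e f : M.

Definition dag x : M := map_mx Num.conj x^T.

Lemma dagE x i j : dag x i j = (x j i)^*.
Proof. by rewrite !mxE. Qed.

Lemma dagK : involutive dag.
Proof. by move=> x; apply/matrixP=> i j; rewrite !dagE conjCK. Qed.

Lemma dagD x y : dag (x + y) = dag x + dag y.
Proof. by rewrite /dag linearD map_mxD. Qed.

Lemma dagN x : dag (- x) = - dag x.
Proof. by rewrite /dag linearN map_mxN. Qed.

Lemma dagB x y : dag (x - y) = dag x - dag y.
Proof. by rewrite dagD dagN. Qed.

Lemma dag0 : dag 0 = 0.
Proof. by rewrite /dag trmx0 map_mx0. Qed.

Lemma dag1 : dag 1 = 1.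
Proof. by rewrite /dag trmx1 map_mx1. Qed.

Lemma dagZ a x : dag (a *: x) = a^* *: dag x.
Proof. by rewrite /dag linearZ map_mxZ. Qed.

Lemma dagM x y : dag (x * y) = dag y * dag x.
Proof. by rewrite /dag trmx_mul map_mxM. Qed.

Lemma dag_sum (I : Type) (r : seq I) (P : pred I) (F : I -> M) :
  dag (\sum_(i <- r | P i) F i) = \sum_(i <- r | P i) dag (F i).
Proof. exact: (big_morph _ dagD dag0). Qed.

(** Each diagonal entry of [x * dag x] is the squared norm of a row of [x]. *)
Lemma mul_dag_eq0 x : (x * dag x == 0) = (x == 0).
Proof.
apply/eqP/eqP=> [xx0|->]; last by rewrite mul0r.
apply/matrixP=> i j; rewrite mxE.
have /matrixP/(_ i i) := xx0; rewrite !mxE => /eqP.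
rewrite psumr_eq0 => [|k _]; last by rewrite dagE mul_conjC_ge0.
by move/allP/(_ j (mem_index_enum _)); rewrite dagE mul_conjC_eq0 => /eqP.
Qed.

Definition is_proj e := (dag e == e) && (e * e == e).

Lemma projP e : reflect (dag e = e /\ e * e = e) (is_proj e).
Proof. by apply: (iffP andP) => -[/eqP h /eqP]. Qed.

Lemma is_proj_compl e : is_proj e -> is_proj (1 - e).
Proof.
case/projP=> ae ee; apply/projP; rewrite dagB dag1 ae; split=> //.
by rewrite mulrBr mulr1 mulrBl mul1r ee subrr subr0.
Qed.

Lemma is_projM e f : is_proj e -> is_proj f -> e * f = f * e -> is_proj (e * f).
Proof.
case/projP=> ae ee /projP[af ff] ef; apply/projP; split.
  by rewrite dagM ae af ef.
by rewrite mulrA -(mulrA e) -ef !mulrA ee -mulrA ff.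
Qed.

Lemma dag_mul0 e f : dag e = e -> dag f = f -> e * f = 0 -> f * e = 0.
Proof. by move=> ae af /(congr1 dag); rewrite dagM ae af dag0. Qed.

Lemma is_proj_sum (I : finType) (P : pred I) (E : I -> M) :
    (forall i, is_proj (E i)) -> (forall i j, i != j -> E i * E j = 0) ->
  is_proj (\sum_(i | P i) E i).
Proof.
move=> pE oE; apply/projP; split.
  by rewrite dag_sum; apply: eq_bigr => i _; case/projP: (pE i).
rewrite mulr_suml; apply: eq_bigr => i Pi.
rewrite mulr_sumr (bigD1 i) //= big1 ?addr0; first by case/projP: (pE i).
by move=> j /andP[_ ji]; rewrite oE // eq_sym.
Qed.

Definition star_algebra (A : {vspace M}) :=
  [/\ 1 \in A, {in A &, forall x y, x * y \in A} & {in A, forall x, dag x \in A}].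

(** * Spectral projections of a self-adjoint matrix *)

Section SpectralIdempotents.
Variable h : M.
Hypothesis dagh : dag h = h.

Let P := spectralmx h.
Let d := spectral_diag h.

Definition spectrum := undup [seq d 0 i | i <- enum 'I_n.+1].

(** The orthogonal projection onto the eigenspace for [a], which is zero when [a] is not an
    eigenvalue. *)
Definition spectral_proj a : M :=
  invmx P *m diag_mx (\row_i (d 0 i == a)%:R) *m P.

Let Pu : P \is a GRing.unit. Proof. exact: spectral_unit. Qed.

Let hE : h = invmx P *m diag_mx d *m P.
Proof.
apply/orthomx_spectralP/normalmxP.
by rewrite -[map_mx _ _]/(dag h) dagh.
Qed.

Lemma is_proj_spectral a : is_proj (spectral_proj a).
Proof.
apply/projP; rewrite /spectral_proj; split.
  rewrite /dag !trmx_mul !map_mxM tr_diag_mx map_diag_mx mulmxA.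
  rewrite invmx_unitary ?spectral_unitarymx // trmxCK.
  congr (_ *m diag_mx _ *m _).
  by apply/rowP=> i; rewrite !mxE; case: eqP; rewrite ?rmorph1 ?rmorph0.
rewrite -[_ * _]/(_ *m _) !mulmxA mulmxK //; congr (_ *m _).
rewrite -mulmxA mulmx_diag; congr (_ *m diag_mx _).
by apply/rowP=> i; rewrite !mxE -natrM mulnb andbb.
Qed.

Lemma mul_spectral_proj a : h * spectral_proj a = a *: spectral_proj a.
Proof.
rewrite {1}hE /spectral_proj -[_ * _]/(_ *m _) !mulmxA mulmxK //.
rewrite scalemxAl; congr (_ *m _).
rewrite scalemxAr -mulmxA; congr (_ *m _).
apply/matrixP=> i j; rewrite mulmx_diag !mxE.
rewrite -mulrnAr; case: (d 0 i =P a) => [->|_]; last by rewrite mul0rn !mulr0.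
by [].
Qed.

Lemma sum_spectral_proj : \sum_(a <- spectrum) spectral_proj a = 1.
Proof.
rewrite -mulmx_suml -mulmx_sumr -[X in _ = X](mulVr Pu); congr (_ *m _).
rewrite -[RHS]mulmx1; congr (_ *m _).
apply/matrixP=> i j; rewrite summxE !mxE.
have [<-|/negPf ij] := eqVneq i j; last by apply: big1 => a _; rewrite !mxE ij.
rewrite (bigD1_seq (d 0 i)) ?undup_uniq //=; last first.
  by rewrite mem_undup map_f ?mem_enum.
rewrite !mxE !eqxx mulr1n big1 ?addr0 // => a /negPf ai.
by rewrite !mxE eqxx eq_sym ai.
Qed.

(** Lagrange interpolation: [p] is 1 at [a] and 0 at every other eigenvalue. Hence the projection
    lies in every unital algebra containing [h]. *)
Lemma spectral_proj_horner a : exists p, spectral_proj a = horner_mx h p.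
Proof.
pose s := [seq b <- spectrum | b != a].
pose p := \prod_(b <- s) ((a - b)^-1 *: ('X - b%:P)); exists p.
rewrite {1}hE horner_mx_uconjC // horner_mx_diag.
congr (_ *m diag_mx _ *m _); apply/rowP=> i; rewrite !mxE horner_prod.
have [->|nia] := eqVneq; last first.
  rewrite (big_rem (d 0 i)) /= ?hornerE ?subrr ?mulr0 ?mul0r //.
  by rewrite mem_filter nia mem_undup map_f ?mem_enum.
rewrite big_seq big1 // => b; rewrite mem_filter => /andP[ba _].
by rewrite !hornerE mulVf // subr_eq0 eq_sym.
Qed.

End SpectralIdempotents.

(* If a self-adjoint [h] in [e * A * e] is not a multiple of [e], then some
   spectral projection of [h], a polynomial in [h], cuts [e] properly. *)
Lemma primitive_scalar (A : {vspace M}) e x :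
    star_algebra A -> e \in A -> is_proj e -> x \in A ->
    (forall f, f \in A -> is_proj f -> e * f = f -> f = 0 \/ f = e) ->
  exists c, e * x * e = c *: e.
Proof.
move=> sA Ae pe Ax prim; have [A1 AM Adag] := sA; have [ae ee] := projP _ pe.
(* The self-adjoint elements of the corner come first. *)
have herm h : h \in A -> dag h = h -> e * h = h -> exists c, h = c *: e.
  move=> Ah ah eh; have he : h * e = h.
    by rewrite -[in RHS]ah -[in RHS]eh dagM ah ae.
  have pa := is_proj_spectral h.
  have ha a : h * spectral_proj h a = a *: spectral_proj h a.
    exact: mul_spectral_proj.
  have Apa a : spectral_proj h a \in A.
    have [p ->] := spectral_proj_horner ah a.
    elim/poly_ind: p => [|p c IH]; first by rewrite rmorph0 mem0v.
    rewrite rmorphD rmorphM /= horner_mx_X horner_mx_C memvD ?AM //.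
    by rewrite -scalemx1 memvZ.
  have ea a : e * spectral_proj h a = spectral_proj h a * e.
    have [p ->] := spectral_proj_horner ah a.
    by apply: comm_mx_horner; rewrite /comm_mx -![_ *m _]/(_ * _) eh he.
  (* The spectral projections sum to 1, so unless [e = 0] one of them is not annihilated by [e];
     primitivity then makes its product with [e] equal to [e]. *)
  have [a aE] : exists a, e = 0 \/ e * spectral_proj h a = e.
    apply: contrapT => noa.
    have ea0 a : e * spectral_proj h a = 0.
      have [|||//|ae'] := prim (e * spectral_proj h a).
      + exact: AM.
      + exact: is_projM.
      + by rewrite mulrA ee.
      + by case: noa; exists a; right.
    case: noa; exists 0; left.
    by rewrite -[e]mulr1 -(sum_spectral_proj h) mulr_sumr big1.
  exists a; case: aE => [e0|eE]; first by rewrite e0 scaler0 -eh e0 mul0r.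
  by rewrite -he -{1}eE ea mulrA ha -scalerAl -ea eE.
set y := e * x * e.
have Ay : y \in A by rewrite !AM.
have ey : e * y = y by rewrite /y !mulrA ee.
have ye : y * e = y by rewrite /y -!mulrA ee.
have eay : e * dag y = dag y by rewrite -{1}ae -dagM ye.
have [||| c1 c1E] := herm (y + dag y).
- by rewrite memvD ?Adag.
- by rewrite dagD dagK addrC.
- by rewrite mulrDr ey eay.
have [||| c2 c2E] := herm ('i *: (y - dag y)).
- by rewrite memvZ ?memvB ?Adag.
- by rewrite dagZ conjCi dagB dagK scaleNr -scalerN opprB.
- by rewrite -scalerAr mulrBr ey eay.
(* Recovers [y] from the self-adjoint elements [y + dag y] and ['i *: (y - dag y)]. *)
exists (2%:R^-1 * (c1 - 'i * c2)).
rewrite -scalerA scalerBl -scalerA -c1E -c2E scalerA -expr2 sqrCi scaleN1r opprK.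
rewrite addrACA subrr addr0 -mulr2n -scaler_nat scalerA mulVf ?scale1r //.
by rewrite pnatr_eq0.
Qed.

End Adjoint.

(** * Bounded maxima of undecided predicates *)

Section MaxNat.
Variables (Q : nat -> Prop) (N : nat).

Definition max_below := \max_(k < N.+1 | `[< Q k >]) k.

Lemma leq_max_below k : (k <= N)%N -> Q k -> (k <= max_below)%N.
Proof.
rewrite -ltnS => kN Qk.
exact: (leq_bigmax_cond (Ordinal kN) (asboolT Qk)).
Qed.

Lemma max_belowP : Q 0 -> Q max_below.
Proof.
move=> Q0; have : (0 < #|[pred k : 'I_N.+1 | `[< Q k >]]|)%N.
  by apply/card_gt0P; exists ord0; apply/asboolP.
case/(eq_bigmax_cond (fun k : 'I_N.+1 => k : nat)) => k /asboolP Qk.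
by rewrite /max_below => ->.
Qed.

Lemma max_below_leq : (max_below <= N)%N.
Proof. by apply/bigmax_leqP => k _; rewrite -ltnS. Qed.

End MaxNat.

(** * Canonical representatives of equivalence classes *)

Section ClassRepresentatives.
Variables (I : finType) (R : rel I).
Hypothesis eqR : equivalence_rel R.

(** [pick] depends only on the extension of [R i], so equivalent elements receive the same
    representative. *)
Definition class_repr i := odflt i [pick j | R i j].

Lemma class_repr_rel i : R i (class_repr i).
Proof.
rewrite /class_repr; case: pickP => //= _.
by have [] := eqR i i i.
Qed.

Lemma eq_class_repr i j : R i j -> class_repr i = class_repr j.
Proof.
move=> Rij; rewrite /class_repr.
have eqRij k : R i k = R j k by have [_ /(_ Rij)] := eqR i j k.
rewrite (eq_pick eqRij); case: pickP => //= /(_ j).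
by have [->] := eqR j j j.
Qed.

Lemma class_reprP i j : reflect (class_repr i = class_repr j) (R i j).
Proof.
apply: (iffP idP) => [/eq_class_repr //|eqij].
have [ii Rij] := eqR i (class_repr i) j; rewrite Rij ?class_repr_rel // eqij.
have [jj Rjj] := eqR j (class_repr j) j.
by rewrite -Rjj ?class_repr_rel.
Qed.

Lemma class_repr_id i : class_repr (class_repr i) = class_repr i.
Proof. exact/esym/eq_class_repr/class_repr_rel. Qed.

Definition class_reprs := [set i | class_repr i == i].

End ClassRepresentatives.

(** Taking [S]-representatives maps the representatives of the finer relation [R] onto those of [S];
    the cardinality bound makes this surjection injective. *)
Lemma equivalence_card_sub (I : finType) (R S : rel I) :
    equivalence_rel R -> equivalence_rel S -> subrel R S ->
    (#|class_reprs R| <= #|class_reprs S|)%N ->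
  subrel S R.
Proof.
move=> eqR eqS sRS leRS.
have reprSR i : class_repr S (class_repr R i) = class_repr S i.
  exact/esym/(eq_class_repr eqS)/sRS/class_repr_rel.
have injS : {in class_reprs R &, injective (class_repr S)}.
  apply/imset_injP; rewrite eqn_leq leq_imset_card (leq_trans leRS) //.
  apply/subset_leq_card/subsetP => i; rewrite inE => /eqP iE.
  apply/imsetP; exists (class_repr R i); last by rewrite reprSR.
  by rewrite inE class_repr_id.
move=> i j /(class_reprP eqS) Sij; apply/(class_reprP eqR)/injS.
- by rewrite inE class_repr_id.
- by rewrite inE class_repr_id.
- by rewrite !reprSR.
Qed.

(** * Families of orthogonal projections and two monotone invariants *)

Section ProjFamilies.
Variables (C : numClosedFieldType) (n : nat).
Local Notation M := 'M[C]_n.+1.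
Implicit Types (A B : {vspace M}) (x y z e f : M) (s : seq M).

Definition proj_family A s :=
  all (fun e => [&& e \in A, e != 0 & is_proj e]) s &&
  pairwise (fun e f => e * f == 0) s.

Lemma proj_family_map A (I : eqType) (r : seq I) (E : I -> M) :
    uniq r ->
    {in r, forall i, [&& E i \in A, E i != 0 & is_proj (E i)]} ->
    {in r &, forall i j, i != j -> E i * E j = 0} ->
  proj_family A (map E r).
Proof.
move=> ur rE oE; apply/andP; split; first by rewrite all_map; apply/allP.
rewrite pairwise_map; move: ur; rewrite uniq_pairwise.
have rr : all (mem r) r by apply/allP.
by apply: (sub_in_pairwise _ rr) => i j ir jr /= ij; rewrite oE.
Qed.

Lemma proj_family_cat A s t : proj_family A s -> proj_family A t ->
    {in s & t, forall e f, e * f = 0} -> proj_family A (s ++ t).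
Proof.
case/andP=> s1 s2 /andP[t1 t2] st; rewrite /proj_family all_cat s1 t1.
rewrite pairwise_cat s2 t2 !andbT /=.
by apply/allrelP => e f es ft; rewrite st.
Qed.

Lemma proj_family_nth A s (i : 'I_(size s)) : proj_family A s ->
  [&& s`_i \in A, s`_i != 0 & is_proj s`_i].
Proof. by case/andP=> /all_nthP sA _; apply: sA. Qed.

Lemma proj_family_orth A s (i j : 'I_(size s)) : proj_family A s ->
  i != j -> s`_i * s`_j = 0.
Proof.
move=> sA; have [_ /(pairwiseP 0) os] := andP sA.
have dags k : dag s`_(k : 'I_(size s)) = s`_k.
  by have /and3P[_ _ /projP[]] := proj_family_nth k sA.
move=> ij; case: (ltngtP i j) => [lij|lji|/val_inj eqij].
- by apply/eqP; apply: os; rewrite ?inE.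
- by apply: dag_mul0 => //; apply/eqP; apply: os; rewrite ?inE.
- by rewrite eqij eqxx in ij.
Qed.

Lemma proj_familyS A B s : (A <= B)%VS -> proj_family A s -> proj_family B s.
Proof.
move=> sAB /andP[sA os]; apply/andP; split=> //; apply: sub_all sA => e.
by case/and3P=> /(subvP sAB) -> -> ->.
Qed.

(** Choose a nonzero row in each projection. These rows are linearly independent, since right
    multiplication by one projection fixes its own row and kills the others. *)
Lemma size_proj_family A s : proj_family A s -> (size s <= n.+1)%N.
Proof.
move=> sA; have nz (i : 'I_(size s)) : exists k, row k s`_i != 0.
  have /and3P[_ /eqP si _] := proj_family_nth i sA.
  apply: contrapT => no; apply: si; apply/row_matrixP => k.
  by rewrite row0; apply/eqP; apply: contraT => kP; case: no; exists k.
have [k kP] := choice nz.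
pose X : 'M[C]_(size s, n.+1) := \matrix_i row (k i) s`_i.
have XE i : X *m s`_(i : 'I_(size s)) =
    \matrix_j (if j == i then row (k i) s`_i else 0).
  apply/row_matrixP => j; rewrite row_mul !rowK -row_mul -[_ *m _]/(_ * _).
  have [->|ji] := eqVneq.
    by have /and3P[_ _ /projP[_ ->]] := proj_family_nth i sA.
  by rewrite (proj_family_orth sA ji) row0.
suff : row_free X by rewrite /row_free => /eqP <-; apply: rank_leq_col.
apply: inj_row_free => v vX0; apply/rowP => i; rewrite mxE.
have := congr1 (mulmx^~ s`_i) vX0; rewrite mul0mx -mulmxA XE mulmx_sum_row.
rewrite (bigD1 i) //= rowK eqxx big1 => [|j /negPf ji]; last first.
  by rewrite rowK ji scaler0.
by rewrite addr0 => /eqP; rewrite scaler_eq0 (negPf (kP i)) orbF => /eqP.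
Qed.

(* For a self-adjoint algebra [A], this says that [e] generates [A] as a
   two-sided ideal; in this form it is visibly monotone in [A]. *)
Definition full A e := forall z, {in A, forall x, z * x * e = 0} -> z = 0.

(* With [A ~ M_d1 + ... + M_dc], [proj_rank A = d1 + ... + dc] and
   [full_corank A = (d1 - 1) + ... + (dc - 1)]. *)
Definition proj_rank A :=
  max_below (fun k => exists s, proj_family A s /\ size s = k) n.+1.

Definition full_corank A :=
  max_below (fun k => exists s,
    [/\ proj_family A s, full A (1 - \sum_(e <- s) e) & size s = k]) n.+1.

Lemma proj_rank_geq A s : proj_family A s -> (size s <= proj_rank A)%N.
Proof.
by move=> sA; apply: leq_max_below; [apply: size_proj_family sA | exists s].
Qed.

Lemma proj_rankP A : exists2 s, proj_family A s & size s = proj_rank A.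
Proof.
suff : exists s, proj_family A s /\ size s = proj_rank A by case=> s []; exists s.
by apply: (@max_belowP (fun k => exists s, proj_family A s /\ size s = k));
  exists [::].
Qed.

Lemma full_corank_geq A s :
  proj_family A s -> full A (1 - \sum_(e <- s) e) -> (size s <= full_corank A)%N.
Proof.
by move=> sA fs; apply: leq_max_below; [apply: size_proj_family sA | exists s].
Qed.

Lemma full_corankP A : 1 \in A -> exists s,
  [/\ proj_family A s, full A (1 - \sum_(e <- s) e) & size s = full_corank A].
Proof.
move=> A1; pose Q k := exists s,
  [/\ proj_family A s, full A (1 - \sum_(e <- s) e) & size s = k].
apply: (@max_belowP Q); exists [::]; split=> // z /(_ 1 A1).
by rewrite big_nil subr0 !mulr1.
Qed.

Lemma proj_rankS A B : (A <= B)%VS -> (proj_rank A <= proj_rank B)%N.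
Proof.
by have [s sA <-] := proj_rankP A => sAB; apply/proj_rank_geq/(proj_familyS sAB).
Qed.

Lemma full_corankS A B : 1 \in A -> (A <= B)%VS ->
  (full_corank A <= full_corank B)%N.
Proof.
move=> A1 sAB; have [s [sA fs <-]] := full_corankP A1.
apply: full_corank_geq; first exact: proj_familyS sA.
by move=> z zB; apply: fs => x /(subvP sAB); apply: zB.
Qed.

(** * Projection families of maximal size and their linking relation *)

Section PrimitiveSystem.
Variables (A : {vspace M}) (I : finType) (E : I -> M).
Hypothesis sA : star_algebra A.
Hypothesis EA : forall i, [&& E i \in A, E i != 0 & is_proj (E i)].
Hypothesis EE0 : forall i j, i != j -> E i * E j = 0.
Hypothesis cardI : #|I| = proj_rank A.

Let A1 : 1 \in A. Proof. by case: sA. Qed.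
Let AM : {in A &, forall x y, x * y \in A}. Proof. by case: sA. Qed.
Let Adag : {in A, forall x, dag x \in A}. Proof. by case: sA. Qed.
Let AE i : E i \in A. Proof. by have /and3P[] := EA i. Qed.
Let E0 i : E i != 0. Proof. by have /and3P[] := EA i. Qed.
Let pE i : is_proj (E i). Proof. by have /and3P[] := EA i. Qed.
Let dagEi i : dag (E i) = E i. Proof. by have /projP[] := pE i. Qed.
Let EE i : E i * E i = E i. Proof. by have /projP[] := pE i. Qed.

(** Otherwise the complement of the sum would be one more orthogonal projection, against
    maximality. *)
Lemma sum_primitive_system : \sum_i E i = 1.
Proof.
pose e := 1 - \sum_i E i; have pe : is_proj e by apply/is_proj_compl/is_proj_sum.
have eE i : e * E i = 0.
  rewrite mulrBl mul1r mulr_suml (bigD1 i) //= EE big1 ?addr0 ?subrr //.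
  by move=> j ji; rewrite EE0.
apply/eqP; rewrite eq_sym -subr_eq0 -/e; apply: contraPT isT => e0.
suff /proj_rank_geq : proj_family A (e :: map E (enum I)).
  by rewrite /= size_map -cardE cardI ltnn.
rewrite -cat1s; apply: proj_family_cat.
- have Ae : e \in A by rewrite memvB ?memv_suml.
  by rewrite /proj_family /= Ae e0 pe.
- by apply: proj_family_map; rewrite ?enum_uniq // => i j _ _; apply: EE0.
- by move=> x y /[!inE] /eqP-> /mapP[i _ ->].
Qed.

Lemma peirce_ext x y : (forall i j, E i * x * E j = E i * y * E j) -> x = y.
Proof.
have peirce z : z = \sum_i \sum_j E i * z * E j.
  under eq_bigr do rewrite -mulr_sumr sum_primitive_system mulr1.
  by rewrite -mulr_suml sum_primitive_system mul1r.
move=> xy; rewrite (peirce x) (peirce y).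
by apply: eq_bigr => i _; apply: eq_bigr => j _.
Qed.

(** Each [E i] is primitive: a proper subprojection [f] would allow replacing [E i] by [f] and
    [E i - f], a longer family. *)
Lemma primitive_system_scalar i x : x \in A ->
  exists c, E i * x * E i = c *: E i.
Proof.
move=> Ax; apply: (primitive_scalar sA) => // f Af pf Ef.
have [af ff] := projP _ pf.
have fE : f * E i = f by rewrite -[RHS]af -[in RHS]Ef dagM af dagEi.
have [f0|f0] := eqVneq f 0; first by left.
have [fEi|fEi] := eqVneq (E i - f) 0.
  by right; apply/esym/eqP; rewrite -subr_eq0 fEi.
have pg : is_proj (E i - f).
  apply/projP; rewrite dagB dagEi af; split=> //.
  by rewrite mulrBr !mulrBl EE Ef fE ff subrr subr0.
have fj j : j != i -> f * E j = 0.
  by move=> ji; rewrite -fE -mulrA EE0 ?mulr0 // eq_sym.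
suff /proj_rank_geq : proj_family A ([:: f; E i - f] ++ map E (rem i (enum I))).
  have cI : (0 < #|I|)%N by apply/card_gt0P; exists i.
  rewrite size_cat size_map size_rem ?mem_enum //= -cardE.
  by rewrite add2n prednK // cardI ltnn.
apply: proj_family_cat.
- rewrite /proj_family /= Af f0 pf fEi pg memvB // !andbT.
  by rewrite mulrBr fE ff subrr eqxx.
- apply: proj_family_map; rewrite ?rem_uniq ?enum_uniq //.
  by move=> j k _ _; apply: EE0.
move=> x' y /[!inE] xE /mapP[j].
rewrite mem_rem_uniq ?enum_uniq // inE => /andP[ji _] ->.
case/orP: xE => /eqP->; first exact: fj.
by rewrite mulrBl fj // EE0 ?subrr // eq_sym.
Qed.

(** Linked indices are those lying in the same simple block of [A]. *)
Definition linked : rel I :=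
  fun i j => `[< exists2 x, x \in A & E i * x * E j != 0 >].

Lemma linkedPn i j x : ~~ linked i j -> x \in A -> E i * x * E j = 0.
Proof.
by move/asboolP=> nl Ax; apply: contra_notP nl => /eqP; exists x.
Qed.

(** The left side is [w * dag w] for [w = E i * x * E j]. Thus a nonzero corner element is
    invertible between its two projections, up to a scalar. *)
Lemma linked_scalar i j x : x \in A -> E i * x * E j != 0 ->
  exists2 c, c != 0 & E i * x * E j * dag x * E i = c *: E i.
Proof.
move=> Ax xij; have [c cE] : exists c, E i * (x * E j * dag x) * E i = c *: E i.
  by apply: primitive_system_scalar; rewrite !AM ?Adag.
rewrite !mulrA in cE; exists c => //; apply: contra_neq xij => c0; apply/eqP.
rewrite -mul_dag_eq0 !dagM !dagEi -!mulrA (mulrA (E j)) EE.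
by rewrite !mulrA cE c0 scale0r.
Qed.

Lemma linked_equiv : equivalence_rel linked.
Proof.
have linked_sym i j : linked i j -> linked j i.
  move=> /asboolP[x Ax xij]; apply/asboolP; exists (dag x); first exact: Adag.
  apply: contra_neq xij => /(congr1 (@dag C n)).
  by rewrite !dagM dagK !dagEi dag0 mulrA.
have linked_trans i j k : linked i j -> linked j k -> linked i k.
  move=> /asboolP[x Ax xij] /asboolP[y Ay yjk]; apply/asboolP.
  exists (x * E j * y); first by rewrite !AM.
  apply: contra_neq xij => xyik.
  have [c c0 cE] := linked_scalar Ay yjk.
  (* Multiplying the vanishing product on the right by [dag y * E j] leaves [c] times the corner of
     [x]. *)
  apply: (scalerI c0); rewrite scaler0 scalerAr -cE !mulrA -(mulrA (E i)).
  by move: xyik; rewrite !mulrA => ->; rewrite !mul0r.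
move=> i j k; split.
  by apply/asboolP; exists 1; rewrite // mulr1 EE.
move=> lij; apply/idP/idP; last exact: linked_trans.
by apply: linked_trans; apply: linked_sym.
Qed.

Local Notation reprs := (class_reprs linked).
Local Notation repr := (class_repr linked).

(** Drop one representative per linked class. The remaining projections have as complement the sum
    of the representatives, which meets every block and is therefore full. *)
Lemma card_leq_full_corank : (#|I| <= full_corank A + #|reprs|)%N.
Proof.
rewrite -(cardC (mem reprs)) addnC leq_add2r cardE.
rewrite -(size_map E); apply: full_corank_geq.
  by apply: proj_family_map; rewrite ?enum_uniq // => i j _ _; apply: EE0.
rewrite big_map big_enum -sum_primitive_system /=.
rewrite (bigID (mem reprs)) /= addrK => z z0.
rewrite -[z]mulr1 -sum_primitive_system mulr_sumr big1 // => j _.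
have /asboolP[x Ax xjk] := class_repr_rel linked_equiv j.
set k := repr j in xjk.
have [c c0 cE] := linked_scalar Ax xjk.
apply: (scalerI c0); rewrite scaler0 scalerAr -cE !mulrA.
have /(congr1 ( *%R^~ (E k))) := z0 (E j * x) (AM (AE j) Ax).
rewrite mul0r -mulrA mulr_suml (bigD1 k) /=; last first.
  by rewrite inE class_repr_id //; apply: linked_equiv.
rewrite EE big1 ?addr0 => [|i /andP[_ ik]]; last by rewrite EE0.
by rewrite !mulrA => ->; rewrite !mul0r.
Qed.

(** The complement [e] of an optimal family meets every block, so the pieces of [e] in the blocks
    can be appended to that family; [proj_rank A] bounds the total size. *)
Lemma full_corank_leq_card : (full_corank A + #|reprs| <= #|I|)%N.
Proof.
have [s [sP fs <-]] := full_corankP A1; set e := 1 - _ in fs.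
(* The central projection onto the block of [t]. *)
pose Z t := \sum_(i | repr i == t) E i.
have pZ t : is_proj (Z t) by apply: is_proj_sum.
have AZ t : Z t \in A by apply: memv_suml.
have ZZ0 t u : t != u -> Z t * Z u = 0.
  move=> tu; rewrite mulr_suml big1 // => i /eqP it; rewrite mulr_sumr big1 //.
  move=> j /eqP ju; apply: EE0; apply: contra_neq tu => ij.
  by rewrite -it -ju ij.
have EZ i t : E i * Z t = (repr i == t)%:R *: E i.
  rewrite mulr_sumr; have [it|it] := eqVneq; rewrite /= ?scale1r ?scale0r.
    rewrite (bigD1 i) /= ?it // EE big1 ?addr0 // => j /andP[_ ji].
    by rewrite EE0 // eq_sym.
  by rewrite big1 // => j jt; rewrite EE0 //; apply: contra_neq it => ->; apply/eqP.
have dagZt t : dag (Z t) = Z t by have /projP[] := pZ t.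
have ZE i t : Z t * E i = (repr i == t)%:R *: E i.
  have /(congr1 (@dag C n)) := EZ i t; rewrite dagM dagZt dagEi => ->.
  by rewrite dagZ dagEi; case: eqP; rewrite ?rmorph1 ?rmorph0.
have ZC t x : x \in A -> Z t * x = x * Z t.
  move=> Ax; apply: peirce_ext => i j; rewrite !mulrA EZ -[RHS]mulrA ZE.
  rewrite -!scalerAl -!scalerAr.
  have [/(eq_class_repr linked_equiv)-> //|nl] := boolP (linked i j).
  by rewrite (linkedPn nl Ax) !scaler0.
have se f : f \in s -> f * e = 0.
  move=> /(nthP 0)[k ks <-]; rewrite /e mulrBr mulr1 (big_nth 0) big_mkord.
  have /and3P[_ _ /projP[_ kk]] := proj_family_nth (Ordinal ks) sP.
  rewrite mulr_sumr (bigD1 (Ordinal ks)) //= kk big1 ?addr0 ?subrr // => j ji.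
  have := proj_family_orth (i := Ordinal ks) (j := j) sP.
  by rewrite eq_sym => ->.
have [pe Ae] : is_proj e /\ e \in A.
  rewrite /e (big_nth 0) big_mkord; split.
    apply/is_proj_compl/is_proj_sum => [i|i j].
      by have /and3P[] := proj_family_nth i sP.
by move=> ij; apply: (proj_family_orth sP ij).
  apply: memvB => //; apply: memv_suml => i _.
  by have /and3P[] := proj_family_nth i sP.
have [dage ee] := projP _ pe.
rewrite cardE -(size_map (fun t => e * Z t)) -size_cat cardI.
apply/proj_rank_geq/proj_family_cat => //; last first.
  by move=> f _ /se fe /mapP[t _ ->]; rewrite mulrA fe mul0r.
apply: proj_family_map; rewrite ?enum_uniq //.
  move=> t; rewrite mem_enum inE => /eqP tt; rewrite AM // is_projM // ?ZC // andbT /=.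
  (* If [e * Z t] vanished, centrality would give [Z t * x * e = 0] on all of [A], so fullness would
     force [Z t = 0]. *)
  apply: contraTneq isT => eZ0; have := E0 t.
  have /(congr1 ( *%R (E t))) : Z t = 0; last first.
    by rewrite EZ tt eqxx scale1r mulr0 => ->; rewrite eqxx.
  by apply: fs => x Ax; rewrite ZC // -mulrA ZC // eZ0 mulr0.
move=> t u _ _ tu.
by rewrite -(mulrA e) (mulrA (Z t)) ZC // -(mulrA e (Z t)) ZZ0 ?mulr0.
Qed.

End PrimitiveSystem.
End ProjFamilies.

(** * Length of chains of self-adjoint algebras *)

Section Chains.
Variables (C : numClosedFieldType) (n : nat).
Local Notation M := 'M[C]_n.+1.

Lemma star_algebra_rigid (A B : {vspace M}) :
    star_algebra A -> star_algebra B -> (A <= B)%VS ->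
    proj_rank A = proj_rank B -> full_corank A = full_corank B ->
  A = B.
Proof.
move=> sA sB sAB rAB cAB; have [s sP sE] := proj_rankP A.
pose E (i : 'I_(size s)) := s`_i.
have EA i : [&& E i \in A, E i != 0 & is_proj (E i)] by apply: proj_family_nth.
have EB i : [&& E i \in B, E i != 0 & is_proj (E i)].
  exact/proj_family_nth/(proj_familyS sAB).
have EE0 i j : i != j -> E i * E j = 0 by apply: proj_family_orth sP.
have cA : #|'I_(size s)| = proj_rank A by rewrite card_ord.
have cB : #|'I_(size s)| = proj_rank B by rewrite -rAB.
have linkAB : subrel (linked A E) (linked B E).
  by move=> i j /asboolP[x /(subvP sAB) Bx xij]; apply/asboolP; exists x.
(* In both algebras the number of classes is the rank minus the corank, so the counts agree. *)
have linkBA : subrel (linked B E) (linked A E).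
  apply: equivalence_card_sub => //; [exact: linked_equiv|exact: linked_equiv|].
  rewrite -(leq_add2l (full_corank A)) {2}cAB.
  apply: leq_trans (full_corank_leq_card sA EA EE0 cA) _.
  exact: card_leq_full_corank.
have [A1 AM Adag] := sA; have [B1 BM Bdag] := sB.
have AE i : E i \in A by have /and3P[] := EA i.
have dagE i : dag (E i) = E i by have /and3P[_ _ /projP[]] := EA i.
have EE i : E i * E i = E i by have /and3P[_ _ /projP[]] := EA i.
have sumE : \sum_i E i = 1 by apply: sum_primitive_system cA.
apply/eqP; rewrite eqEsubv sAB; apply/subvP => y By.
rewrite -[y]mul1r -[_ * y]mulr1 -sumE mulr_suml mulr_sumr memv_suml // => j _.
rewrite mulr_suml memv_suml // => i _.
have [/linkBA /asboolP[x Ax xij]|nl] := boolP (linked B E i j); last first.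
  by rewrite (linkedPn nl By) mem0v.
set w := E i * x * E j in xij.
have Aw : w \in A by rewrite !AM.
have Ew : E i * w = w by rewrite /w !mulrA EE.
have wE : w * E j = w by rewrite /w -!mulrA EE.
have [c cE] : exists c, w * dag w = c *: E i.
  have [c cE] := primitive_system_scalar sA EA EE0 cA i (AM _ _ Aw (Adag _ Aw)).
  by exists c; rewrite -cE mulrA Ew -mulrA -[X in _ = _ * (_ * X)]dagE -dagM Ew.
have c0 : c != 0.
  by apply: contra_neq xij => c0; apply/eqP; rewrite -mul_dag_eq0 cE c0 scale0r.
have Bwy : dag w * y \in B by rewrite BM // Bdag // (subvP sAB).
have [b bE] := primitive_system_scalar sB EB EE0 cB j Bwy.
(* Evaluate [w * dag w * y * E j] in two ways: as [c] times the corner of [y], and as [b *: w]. *)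
have -> : E i * y * E j = (c^-1 * b) *: w.
  apply: (scalerI c0); rewrite scalerA mulrA divff // mul1r.
  have -> : b *: w = w * (b *: E j) by rewrite -scalerAr wE.
  by rewrite -bE !mulrA wE cE !scalerAl.
by rewrite memvZ.
Qed.

(** Rank plus corank is at most [2 * n.+1], and by rigidity it grows at every strict inclusion. *)
Lemma star_algebra_chain (A : nat -> {vspace M}) :
    (forall i, star_algebra (A i)) -> (forall i, (A i <= A i.+1)%VS) ->
  exists2 i, (i <= 2 * n.+1)%N & A i = A i.+1.
Proof.
move=> sA AS; apply: contrapT => noi.
pose phi i := (proj_rank (A i) + full_corank (A i))%N.
suff phi_ge i : (i <= (2 * n.+1).+1)%N -> (i <= phi i)%N.
  have := phi_ge _ (leqnn _); rewrite ltnNge mul2n -addnn.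
  by rewrite leq_add // max_below_leq.
elim: i => // i IH iN; apply: leq_ltn_trans (IH (ltnW iN)) _.
have A1 : 1 \in A i by case: (sA i).
have rS := proj_rankS (AS i); have cS := full_corankS A1 (AS i).
rewrite ltn_neqAle leq_add // andbT; apply/eqP => phiE; apply: noi; exists i => //.
apply: star_algebra_rigid => //.
  apply/eqP; rewrite eqn_leq rS -(leq_add2r (full_corank (A i))) /=.
  by rewrite [leqRHS]phiE leq_add2l.
apply/eqP; rewrite eqn_leq cS -(leq_add2l (proj_rank (A i))) /=.
by rewrite [leqRHS]phiE leq_add2r.
Qed.

End Chains.

(** * Matrices constant on color classes *)

Section ColorSpaces.
Variables (F : numClosedFieldType) (n : nat) (V : finType) (v : 'I_n.+1 -> V).
Hypothesis v_bij : bijective v.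
Local Notation M := 'M[F]_n.+1.

Section OneColoring.
Variables (K : choiceType) (chi : V * V -> K).

Definition color_at (q : 'I_n.+1 * 'I_n.+1) := chi (v q.1, v q.2).

Definition color_mx c : M := \matrix_(i, j) (color_at (i, j) == c)%:R.

Definition color_mxs :=
  [seq color_mx (color_at q) | q <- enum {: 'I_n.+1 * 'I_n.+1}].

Definition color_space : {vspace M} := <<color_mxs>>%VS.

Lemma color_spaceP (x : M) : reflect
  (forall q q', color_at q = color_at q' -> x q.1 q.2 = x q'.1 q'.2)
  (x \in color_space).
Proof.
apply: (iffP idP) => [xX q q' qq'|xP].
  rewrite (coord_span (X := in_tuple color_mxs) xX) !summxE.
  apply: eq_bigr => k _; rewrite !mxE.
  congr (_ * _).
  have /mapP[q0 _ ->] : color_mxs`_k \in color_mxs by rewrite mem_nth.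
  by rewrite !mxE -!surjective_pairing qq'.
pose m q : F := #|[pred q' | color_at q' == color_at q]|%:R.
(* Summing over positions repeats each class as often as its size [m q], hence the division. *)
have -> : x = \sum_q (x q.1 q.2 / m q) *: color_mx (color_at q).
  apply/matrixP => i j; rewrite summxE.
  rewrite (bigID [pred q | color_at q == color_at (i, j)]) /=.
  rewrite [X in _ + X]big1 => [|q].
    rewrite addr0 (eq_bigr (fun _ => x i j / m (i, j))) => [|q /eqP qij].
      rewrite sumr_const -mulr_natr -/(m (i, j)) mulfVK //.
      by rewrite pnatr_eq0 -lt0n; apply/card_gt0P; exists (i, j); rewrite inE.
    rewrite !mxE qij eqxx mulr1 (xP q (i, j)) // /m.
    by congr (_ / _%:R); apply: eq_card => q'; rewrite !inE qij.
  by rewrite eq_sym !mxE => /negPf->; rewrite mulr0.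
apply: memv_suml => q _; apply: memvZ; apply: memv_span.
by apply: map_f; rewrite mem_enum.
Qed.

Lemma color_mx_mem c : color_mx c \in color_space.
Proof.
by apply/color_spaceP => q q' qq'; rewrite !mxE -!surjective_pairing qq'. Qed.

Lemma color_space_factor x : x \in color_space ->
  exists g, forall i j, x i j = g (chi (v i, v j)).
Proof.
move/color_spaceP => xP.
exists (fun c => if [pick q | color_at q == c] is Some q then x q.1 q.2 else 0).
move=> i j; case: pickP => [q /eqP/(xP q (i, j)) -> //|/(_ (i, j))].
by rewrite eqxx.
Qed.

Definition flip_stable := forall a b a' b',
  chi (a, b) = chi (a', b') -> chi (b, a) = chi (b', a').

Lemma dag_color_space x : flip_stable -> x \in color_space -> dag x \in color_space.
Proof.
move=> st /color_spaceP xP; apply/color_spaceP => q q' qq'; rewrite !dagE.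
by congr (_^*); apply: (xP (q.2, q.1) (q'.2, q'.1)); apply: st.
Qed.

End OneColoring.

(** An entry of [x * y] sums products of values determined by the color pairs, so it depends only on
    their multiset. *)
Lemma mul_color_space (K : choiceType) (chi : V * V -> K) x y :
    x \in color_space chi -> y \in color_space chi ->
  x * y \in color_space (wl_refine chi).
Proof.
move=> /color_space_factor[g gE] /color_space_factor[h hE].
have xyE q : (x * y) q.1 q.2 =
    \sum_(c <- wl_refine chi (v q.1, v q.2)) g c.1 * h c.2.
  rewrite (perm_big _ (perm_eq_seq_mset _)) big_map big_enum /=.
  rewrite (reindex v) /=; last exact: onW_bij.
  by rewrite -[x * y]/(x *m y) mxE; apply: eq_bigr => k _; rewrite gE hE.
apply/color_spaceP => q q' qq'.
by rewrite !xyE -[wl_refine _ _]/(color_at _ q) qq'.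
Qed.

Definition color_pairs (K : choiceType) (chi : V * V -> K) a b :=
  [seq (chi (a, k), chi (k, b)) | k <- enum V].

Lemma wl_refineP (K : choiceType) (chi : V * V -> K) a b a' b' :
  reflect (wl_refine chi (a, b) = wl_refine chi (a', b'))
    (perm_eq (color_pairs chi a b) (color_pairs chi a' b')).
Proof. exact: eq_seq_msetP. Qed.

Lemma flip_stable_wl_refine (K : choiceType) (chi : V * V -> K) :
  flip_stable chi -> flip_stable (wl_refine chi).
Proof.
move=> st a b a' b' /wl_refineP ab; apply/wl_refineP.
(* The map that reversal induces on colors; colors that do not occur are left fixed. *)
pose tau c := if [pick q | chi q == c] is Some q then chi (q.2, q.1) else c.
have tauE u w : chi (w, u) = tau (chi (u, w)).
  rewrite /tau; case: pickP => [[u' w'] /eqP|/(_ (u, w)) /=]; last by rewrite eqxx.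
  by move/st.
have flipE u w :
    color_pairs chi w u = [seq (tau c.2, tau c.1) | c <- color_pairs chi u w].
  rewrite /color_pairs -[RHS]map_comp.
  by apply: eq_map => k /=; congr (_, _); apply: tauE.
by rewrite (flipE a b) (flipE a' b'); apply: perm_map.
Qed.

Lemma color_partition_eq (K L : choiceType) (chi : V * V -> K) (psi : V * V -> L) :
    (forall p q, (chi p == chi q) = (psi p == psi q)) ->
  color_partition chi = color_partition psi.
Proof.
move=> eqc; rewrite /color_partition /preim_partition /equivalence_partition.
by apply: eq_imset => p; apply/setP => q; rewrite !inE /= eqc.
Qed.

Lemma color_partition_stable (K : choiceType) (chi : V * V -> K) :
    1 \in color_space chi ->
    {in color_space chi &, forall x y, x * y \in color_space chi} ->
  color_partition chi = color_partition (wl_refine chi).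
Proof.
move=> chi1 chiM; apply: color_partition_eq => p q.
have [w vK wK] := v_bij.
pose ix (p : V * V) := (w p.1, w p.2).
have ixE (L : choiceType) (psi : V * V -> L) p' : psi p' = color_at psi (ix p').
  by rewrite /color_at !wK -surjective_pairing.
rewrite ixE (ixE _ _ q) (ixE _ (wl_refine chi)) (ixE _ (wl_refine chi) q).
move: (ix p) (ix q) => {p q} p q.
apply/eqP/eqP => pq.
  apply/wl_refineP/allP => -[c d] _ /=; apply/eqP.
  (* Products of class indicators count color pairs, so closure under products makes each
     multiplicity a function of the old color. *)
  have countE r : (color_mx chi c * color_mx chi d) r.1 r.2 =
      (count_mem (c, d) (color_pairs chi (v r.1) (v r.2)))%:R.
    rewrite -[_ * _]/(_ *m _) mxE /color_pairs count_map -sum1_count.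
    rewrite natr_sum [RHS]big_mkcond.
    rewrite big_enum /= [RHS](reindex v) /=; last exact: onW_bij.
    apply: eq_bigr => k _; rewrite !mxE /color_at /= -natrM mulnb xpair_eqE.
    by case: ifP.
  have := color_spaceP _ _ (chiM _ _ (color_mx_mem chi c) (color_mx_mem chi d))
    _ _ pq.
  by rewrite !countE => /eqP; rewrite eqr_nat => /eqP.
(* A refined color does not store the old one; multiplying a class indicator by 1 shows that it
   still determines it. *)
have := mul_color_space (color_mx_mem chi (color_at chi q)) chi1.
rewrite mulr1 => /color_spaceP/(_ _ _ pq)/eqP.
rewrite !mxE -!surjective_pairing eqxx.
by case: (_ =P color_at chi q) => // _; rewrite eq_sym oner_eq0.
Qed.

End ColorSpaces.

(** [dag] reverses words, so it preserves every power of [U]; peeling a factor off the left turns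
    into adding one on the right. *)
Lemma dag_agenv (F : numClosedFieldType) n (U : {vspace 'M[F]_n.+1}) :
    {in U, forall x, dag x \in U} ->
  {in agenv U, forall x, dag x \in agenv U}.
Proof.
move=> Udag; have spanP (W : {vspace 'M[F]_n.+1}) (X : seq 'M[F]_n.+1) :
    {in X, forall x, dag x \in W} -> {in <<X>>%VS, forall x, dag x \in W}.
  move=> XW x xX; rewrite (coord_span (X := in_tuple X) xX) dag_sum.
  apply: memv_suml => i _; rewrite dagZ memvZ // XW //.
  by rewrite mem_nth.
have powP k : {in (U ^+ k)%VS, forall x, dag x \in (U ^+ k)%VS}.
  elim: k => [|k IH].
    by move=> x /vlineP[c ->]; rewrite dagZ dag1 memvZ ?memv_line.
  move=> x; rewrite {1}expvSl [@prodv _ _]unlock.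
  apply: spanP => {}x /allpairsP[[y z] [yU zU ->]] /=.
  rewrite dagM expvSr memv_mul ?IH ?Udag //.
    by rewrite vbasis_mem.
  by rewrite vbasis_mem.
move=> x /memv_sumP[X XU ->]; rewrite dag_sum memv_suml // => i _.
by apply: (subvP (subX_agenv U i)); apply/powP/XU.
Qed.

(** * Algebras generated along the refinement *)

Section Iteration.
Variables (F : numClosedFieldType) (n : nat) (V : finType) (v : 'I_n.+1 -> V).
Hypothesis v_bij : bijective v.
Variables (K : choiceType) (chi : V * V -> K).
Local Notation U m := (color_space F v (wl_iter chi m)).
Hypothesis chi_flip : flip_stable chi.
Hypothesis chi1 : 1 \in U 0.

Lemma wl_iter_flip_stable m : flip_stable (wl_iter chi m).
Proof. by elim: m => [//|m IH]; apply: flip_stable_wl_refine. Qed.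

Lemma wl_iter_prod m : (U m * U m <= U m.+1)%VS.
Proof. by apply/prodvP => x y xU yU; apply: mul_color_space. Qed.

Lemma wl_iter_one m : 1 \in U m.
Proof.
elim: m => // m IH; apply: (subvP (wl_iter_prod m)).
by rewrite -[1]mulr1 memv_mul.
Qed.

Lemma wl_iter_exp m k : (U m ^+ (2 ^ k) <= U (m + k)%N)%VS.
Proof.
elim: k => [|k IH]; first by rewrite addn0.
rewrite expnS mul2n -addnn expvD addnS.
exact: subv_trans (prodvS IH IH) (wl_iter_prod _).
Qed.

Lemma wl_iter_agenv m k : (n.+1 * n.+1 <= 2 ^ k)%N ->
  (agenv (U m) <= U (m + k)%N)%VS.
Proof.
(* [agenv] sums the powers below the dimension [n.+1 * n.+1]; a shorter word is padded with factors
   1 to length [2 ^ k]. *)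
move=> nk; apply/subv_sumP => i _; apply: subv_trans (wl_iter_exp m k).
have ik : (i <= 2 ^ k)%N.
  apply: leq_trans nk; apply: ltnW.
  by have := ltn_ord i; rewrite [X in (_ < X)%N]dimvf /dim.
rewrite -(subnKC ik) expvD -{1}[(_ ^+ i)%VS]prodv1 prodvSr //.
rewrite -(expv1n _ (2 ^ k - i)) expvS // -memvE wl_iter_one //.
Qed.

Lemma wl_iter_star_algebra m : star_algebra (agenv (U m)).
Proof.
split; first by rewrite memvE sub1_agenv.
  by move=> x y xU yU; rewrite -agenvM memv_mul.
by apply: dag_agenv => x; apply: dag_color_space; apply: wl_iter_flip_stable.
Qed.

Lemma wl_iter_stable k : (n.+1 * n.+1 <= 2 ^ k)%N ->
  exists2 i, (i <= 2 * n.+1)%N &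
    color_partition (wl_iter chi (i.+1 * k)) =
    color_partition (wl_iter chi (i.+1 * k).+1).
Proof.
move=> nk; pose A i := agenv (U (i * k)%N).
have UA i : (A i <= U (i.+1 * k)%N)%VS by rewrite mulSn addnC wl_iter_agenv.
have [i|i|i iN AiE] := @star_algebra_chain _ _ A.
- exact: wl_iter_star_algebra.
- exact: subv_trans (UA i) (sub_agenv _).
exists i => //; apply: (color_partition_stable v_bij (wl_iter_one _)).
(* This color space lies between [A i] and [A i.+1], which coincide. *)
have UE : U (i.+1 * k)%N = A i.
  by apply/eqP; rewrite eqEsubv UA andbT AiE sub_agenv.
by rewrite UE; case: (wl_iter_star_algebra (i * k)).
Qed.

End Iteration.

(** * The iteration bound with an explicit constant *)

Theorem theorem1 (R : realType) :
  exists c : R, 0 < c /\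
    forall (n : nat) (V : finType) (e : rel V),
      (2 <= n)%N -> #|V| = n -> symmetric e ->
      exists m : nat,
        m%:R <= c * n%:R * ln n%:R /\
        color_partition (wl_iter (init_coloring e) m) =
        color_partition (wl_iter (init_coloring e) m.+1).
Proof.
have ln2 : 0 < ln 2%:R :> R by rewrite ln_gt0 // ltr1n.
(* With [n.+1] vertices, [i.+1 <= 3 * n.+1] and [k <= 4 * t], where [t] is at most the binary
   logarithm of [n.+1]; hence 12. *)
exists (12%:R / ln 2%:R); split=> [|[//|n] V e n2 cardV e_sym].
  exact: divr_gt0.
pose t := trunc_log 2 n.+1; pose k := (2 * t.+1)%N.
pose v i : V := enum_val (cast_ord (esym cardV) i).
have v_bij : bijective v.
  apply: bij_comp (enum_val_bij V) _.
  by exists (cast_ord cardV); [apply: cast_ordKV | apply: cast_ordK].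
have nk : (n.+1 * n.+1 <= 2 ^ k)%N.
  have nt : (n.+1 <= 2 ^ t.+1)%N by apply/ltnW/trunc_log_ltn.
  by rewrite /k mul2n -addnn expnD leq_mul.
have flip : flip_stable (init_coloring e).
  move=> a b a' b'; rewrite /init_coloring /= (eq_sym b) (eq_sym b').
  by rewrite (e_sym b) (e_sym b').
(* The diagonal has its own initial color -1. *)
have one : 1 \in color_space algC v (wl_iter (init_coloring e) 0).
  apply/color_spaceP => q q'; rewrite /color_at /init_coloring /= !mxE.
  rewrite !(inj_eq (bij_inj v_bij)).
  by case: (q.1 == q.2); case: (q'.1 == q'.2); do ?[case: ifP].
have [i iN stab] := wl_iter_stable v_bij flip one nk.
exists (i.+1 * k)%N; split=> //.
have t1 : (1 <= t)%N by rewrite /t trunc_log_gt0.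
have tln : t%:R * ln 2%:R <= ln n.+1%:R :> R.
  rewrite mulr_natl -lnXn ?ltr0n // -natrX ler_ln ?posrE ?ltr0n ?expn_gt0 //.
  by rewrite ler_nat trunc_logP.
have ikN : (i.+1 * k <= 12 * n.+1 * t)%N.
  have -> : (12 * n.+1 * t = 3 * n.+1 * (4 * t))%N by rewrite mulnACA mulnA.
  apply: leq_mul; last first.
    have -> : (4 * t = 2 * (2 * t))%N by rewrite mulnA.
    by rewrite leq_mul2l /= mul2n -addnn -addn1 leq_add2l.
  by apply: leq_ltn_trans iN _; rewrite ltn_mul2r.
apply: le_trans (_ : 12%:R * n.+1%:R * t%:R <= _).
  by rewrite -!natrM ler_nat.
rewrite (mulrAC 12%:R (_^-1)) -[leRHS]mulrA ler_wpM2l ?mulr_ge0 //.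
by rewrite ler_pdivlMl // mulrC.
Qed.
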